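(* Let $G$ be a finite simple graph with no isolated vertices and let $I$ be its edge ideal. Then $\operatorname{index}(I^{[k]})=1$ for every integer $k$ with $0<k<\nu_0(G)$.
   Context: $K$ is a field and $S=K[x_1,\dots,x_n]$ is the standard graded polynomial ring. The edge ideal of a simple graph $G$ on $[n]=\{1,\dots,n\}$ is the ideal of $S$ generated by the monomials $x_ix_j$ with $\{i,j\}\in E(G)$. For a monomial ideal $J$, $G(J)$ denotes its unique minimal set of monomial generators. For a squarefree monomial ideal $I$, the $k$-th squarefree power $I^{[k]}$ is the monomial ideal generated by all squarefree monomials in $G(I^k)$. A matching of $G$ is a set of edges of $G$ no two of which share a vertex. Two disjoint edges $e,e'$ of $G$ form a gap if there is no edge $f\in E(G)$ with $e\cap f\neq\emptyset\neq e'\cap f$. A restricted matching is a matching in which there is one edge that forms a gap with every other edge of the matching. $\nu_0(G)$ denotes the maximal size of a restricted matching of $G$; if there is no restricted matching, one sets $\nu_0(G)=1$. For a nonzero graded ideal $J\subset S$ generated in a single degree $d$, with graded Betti numbers $\beta_{i,j}(J)=\dim_K\operatorname{Tor}_i^S(J,K)_j$, $J$ is called $r$ steps linear if $\beta_{i,i+j}(J)=0$ for all pairs $(i,j)$ with $0\leq i\leq r$ and $j>d$. The index of $J$ is $\operatorname{index}(J)=\sup\{r : J \text{ is } r \text{ steps linear}\}+1$. *)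

(* Defs.v *)
From HB Require Import structures.
From Stdlib Require Import ClassicalEpsilon.
From mathcomp Require Import all_boot all_order all_algebra.
From mathcomp Require Import freeg mpoly.

Set Implicit Arguments.
Unset Strict Implicit.
Unset Printing Implicit Defensive.

Import GRing.Theory.
Local Open Scope ring_scope.

Section Ideals.
Variables (K : fieldType) (n : nat).
Local Notation S := {mpoly K[n]}.

Definition ideal_gen (A : S -> Prop) (f : S) : Prop :=
  exists2 s : seq (S * S), (forall p, p \in s -> A p.2)
                         & f = \sum_(p <- s) p.1 * p.2.

Definition ideal_mul (I J : S -> Prop) : S -> Prop :=
  ideal_gen (fun h => exists f g, [/\ I f, J g & h = f * g]).

Definition ideal_pow (I : S -> Prop) (k : nat) : S -> Prop :=
  iter k (ideal_mul I) (fun=> True).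

Definition monomial_ideal (A : 'X_{1..n} -> Prop) : S -> Prop :=
  ideal_gen (fun f => exists2 m, A m & f = 'X_[m]).

Definition is_min_mon_gens (J : S -> Prop) (A : 'X_{1..n} -> Prop) : Prop :=
  (forall f, J f <-> monomial_ideal A f) /\
  forall B : 'X_{1..n} -> Prop, (forall m, B m -> A m) ->
    (forall f, J f <-> monomial_ideal B f) -> forall m, A m -> B m.

(** [G(J)]; the set [A] below is unique when it exists. *)
Definition min_mon_gens (J : S -> Prop) (m : 'X_{1..n}) : Prop :=
  exists2 A, is_min_mon_gens J A & A m.

Definition squarefree_mon (m : 'X_{1..n}) : Prop := forall i, (m i <= 1)%N.

Definition squarefree_power (I : S -> Prop) (k : nat) : S -> Prop :=
  monomial_ideal
    (fun m => min_mon_gens (ideal_pow I k) m /\ squarefree_mon m).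

Definition generated_in_degree (J : S -> Prop) (d : nat) : Prop :=
  exists2 A : S -> Prop, (forall f, A f -> f \is d.-homog)
                       & forall f, J f <-> ideal_gen A f.
End Ideals.

(** [subquot_dim Z B d]: the quotient of the subspace [Z] by its subspace [B]
    has dimension [d]. *)
Definition subquot_dim (K : fieldType) (U : lmodType K) (Z B : U -> Prop)
    (d : nat) : Prop :=
  exists v : 'I_d -> U, (forall i, Z (v i)) /\
    forall z, Z z -> exists! c : 'rV[K]_d, B (z - \sum_i c 0 i *: v i).

(** A graded free resolution
      ... -> F_1 -> F_0 -> K -> 0
    of the residue field K = S/(x_1, ..., x_n).  F_i has basis [fgen i] with
    degrees [fdeg], elements are coordinate functions, [fdiff i] is the matrix
    of F_{i+1} -> F_i, and [faug] gives the images in K of the basis of F_0;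
    S acts on K through the constant coefficient. *)
Definition fbd (K : fieldType) (n : nat) (A B : finType)
    (M : A -> B -> {mpoly K[n]}) (f : {ffun A -> {mpoly K[n]}}) :
    {ffun B -> {mpoly K[n]}} :=
  [ffun b => \sum_a f a * M a b].

Record residue_resolution (K : fieldType) (n : nat) := ResidueResolution {
  fgen : nat -> finType;
  fdeg : forall i, fgen i -> nat;
  fdiff : forall i, fgen i.+1 -> fgen i -> {mpoly K[n]};
  faug : fgen 0 -> K;
  fdiff_homog : forall i (a : fgen i.+1) (b : fgen i) m,
    m \in msupp (fdiff a b) -> (mdeg m + fdeg b)%N = fdeg a;
  faug_homog : forall b : fgen 0, faug b != 0 -> fdeg b = 0%N;
  faug_surj : exists b, faug b != 0;
  fexact0 : forall f : {ffun fgen 0 -> {mpoly K[n]}},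
    \sum_b (f b)@_0%MM * faug b = 0 <-> exists g, f = fbd (@fdiff 0) g;
  fexactS : forall i (f : {ffun fgen i.+1 -> {mpoly K[n]}}),
    fbd (@fdiff i) f = 0 <-> exists g, f = fbd (@fdiff i.+1) g
}.

(** Tor_i^S(J, K)_j is the homology of J (x) F in homological degree i and
    internal degree j, where J (x) F_i is identified with J^(fgen i). *)
Section Tor.
Variables (K : fieldType) (n : nat) (F : residue_resolution K n).
Variable J : {mpoly K[n]} -> Prop.
Local Notation chain_type i := {ffun fgen F i -> {mpoly K[n]}}.

Definition tor_chain (i j : nat) (f : chain_type i) : Prop :=
  forall b, J (f b) /\
    forall m, m \in msupp (f b) -> (mdeg m + fdeg b)%N = j.

Definition closed_chain (i : nat) : chain_type i -> Prop :=
  match i with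
  | 0 => fun=> True
  | i'.+1 => fun f => fbd (@fdiff _ _ F i') f = 0
  end.

Definition tor_cycle (i j : nat) (f : chain_type i) : Prop :=
  tor_chain j f /\ closed_chain f.

Definition tor_boundary (i j : nat) (f : chain_type i) : Prop :=
  exists2 g, tor_chain j g & f = fbd (@fdiff _ _ F i) g.

Definition tor_dim (i j : nat) : nat :=
  epsilon (inhabits 0%N) (subquot_dim (@tor_cycle i j) (@tor_boundary i j)).
End Tor.

Section Koszul.
Variables (K : fieldType) (n : nat).
Local Notation S := {mpoly K[n]}.

Definition ksign (x : 'I_n) (s : {set 'I_n}) : K :=
  (-1) ^+ #|[set y in s | (y < x)%N]|.

Definition kgen (i : nat) : finType := {s : {set 'I_n} | #|s| == i}.

(** e_s |-> sum over x in s of +- x e_(s - x) *)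
Definition kdiff (i : nat) (s : kgen i.+1) (t : kgen i) : S :=
  \sum_(x in val s | val s :\ x == val t) ksign x (val s) *: 'X_x.

Definition ktot (f : {set 'I_n} -> S) (t : {set 'I_n}) : S :=
  \sum_(x | x \notin t) ksign x t *: ('X_x * f (x |: t)).

Lemma ksignK x s : ksign x s * ksign x s = 1.
Proof. by rewrite /ksign -exprMn mulrNN mulr1 expr1n. Qed.

Lemma ksignU x y (s : {set 'I_n}) : y \notin s ->
  ksign x (y |: s) = (-1) ^+ (y < x)%N * ksign x s.
Proof.
move=> ys; rewrite /ksign; case: (ltnP y x) => yx.
  have -> : [set z in y |: s | (z < x)%N] = y |: [set z in s | (z < x)%N].
    by apply/setP=> z; rewrite !inE; case: (z =P y) => [->|].
  by rewrite cardsU1 inE (negbTE ys) exprD.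
have -> : [set z in y |: s | (z < x)%N] = [set z in s | (z < x)%N].
  by apply/setP=> z; rewrite !inE; case: (z =P y) => [->|] //=; rewrite ltnNge yx andbF.
by rewrite expr0 mul1r.
Qed.

Lemma ksignUC x y (s : {set 'I_n}) : x != y -> x \notin s -> y \notin s ->
  ksign x s * ksign y (x |: s) = - (ksign y s * ksign x (y |: s)).
Proof.
move=> xy xs ys; rewrite !ksignU //.
have [lt|lt|/val_inj e] := ltngtP x y; last by rewrite e eqxx in xy.
  by rewrite expr1 expr0 mul1r mulN1r mulrN [in RHS]mulrC.
by rewrite expr1 expr0 mul1r mulN1r mulrN opprK mulrC.
Qed.

Lemma ktotK f t : ktot (ktot f) t = 0.
Proof.
pose c (x y : 'I_n) := ksign x t *: ('X_x * (ksign y (x |: t) *: ('X_y * f (y |: (x |: t))))).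
have -> : ktot (ktot f) t =
  \sum_(x | x \notin t) \sum_(y | (y \notin t) && (y != x)) c x y.
  apply: eq_bigr => x xt; rewrite mulr_sumr scaler_sumr.
  by apply: eq_bigl => y; rewrite !inE negb_or andbC.
have cC x y : x \notin t -> y \notin t -> x != y -> c x y = - c y x.
  move=> xt yt xy; rewrite /c -!scalerAr !scalerA (ksignUC xy xt yt) scaleNr.
  by rewrite !mulrA (mulrC 'X_x) setUCA.
pose T := \sum_(x | x \notin t) \sum_(y | (y \notin t) && (y < x)%N) c x y.
have -> : \sum_(x | x \notin t) \sum_(y | (y \notin t) && (y != x)) c x y =
  T + \sum_(x | x \notin t) \sum_(y | (y \notin t) && (x < y)%N) c x y.
  rewrite -big_split /=; apply: eq_bigr => x xt.
  rewrite (bigID (fun y : 'I_n => (y < x)%N)) /=; congr (_ + _); apply: eq_bigl => y.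
    by rewrite -andbA -val_eqE /=; case: ltngtP; rewrite ?andbF ?andbT.
  by rewrite -andbA -val_eqE /=; case: ltngtP; rewrite ?andbF ?andbT.
rewrite (exchange_big_dep (fun y => y \notin t)) /=; last by move=> ? ? _ /andP[].
have -> : \sum_(x | x \notin t) \sum_(y | (y \notin t) && ((x \notin t) && (y < x)%N)) c y x
  = \sum_(x | x \notin t) \sum_(y | (y \notin t) && (y < x)%N) c y x.
  by apply: eq_bigr => x xt; apply: eq_bigl => y; rewrite xt.
rewrite /T -big_split big1 //= => x xt.
rewrite -big_split big1 //= => y /andP[yt yx].
by rewrite (cC x y) // ?addNr // -val_eqE /= gtn_eqF.
Qed.

Lemma mcoeffXU_mul (x : 'I_n) (p : S) m :
  ('X_x * p)@_m = if m x == 0%N then 0 else p@_(m - U_(x))%MM.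
Proof.
rewrite -commr_mpolyX; case: ifPn => mx; last first.
  have e : m = (U_(x) + (m - U_(x)))%MM.
    by rewrite addmC submK // lep1mP.
  by rewrite {1}e mcoeffMX.
rewrite mcoeffM big1 // => [[k1 k2]] /= /eqP e.
rewrite mcoeffX; case: eqP => [e2|]; last by rewrite mulr0.
by have := congr1 (fun k : 'X_{1..n} => k x) e; rewrite /= -e2 mnmDE mnm1E eqxx (eqP mx) addnS.
Qed.

(** [kdown x p] is the quotient of [p] by ['X_x]. *)
Definition kdown (x : 'I_n) (p : S) : S :=
  \sum_(m <- msupp p | (U_(x) <= m)%MM) p@_m *: 'X_[(m - U_(x))%MM].

Lemma mcoeff_kdown x p m : (kdown x p)@_m = p@_(m + U_(x))%MM.
Proof.
rewrite /kdown raddf_sum /= (eq_bigr (fun k => if k == (m + U_(x))%MM then p@_(m + U_(x)) else 0)).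
  rewrite -big_mkcondr /=.
  case: (boolP ((m + U_(x))%MM \in msupp p)) => hm.
    rewrite -big_filter; rewrite (perm_big [:: (m + U_(x))%MM]) ?big_seq1 //.
    apply: uniq_perm => //; first exact/filter_uniq/msupp_uniq.
    move=> k; rewrite mem_filter !inE; case: eqP => [->|]; rewrite ?andbF //.
    by rewrite hm lem_addl.
  by rewrite (memN_msupp_eq0 hm) big1.
move=> k hk; rewrite mcoeffZ mcoeffX.
have -> : ((k - U_(x))%MM == m) = (k == (m + U_(x))%MM).
  apply/eqP/eqP => [<-|->]; first by rewrite submK.
  by rewrite addmK.
by case: eqP => [->|]; rewrite ?mulr1 ?mulr0.
Qed.

Lemma kdownD x p q : kdown x (p + q) = kdown x p + kdown x q.
Proof. by apply/mpolyP => m; rewrite !(mcoeffD, mcoeff_kdown). Qed.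

Lemma kdown0 x : kdown x 0 = 0.
Proof. by apply/mpolyP => m; rewrite mcoeff_kdown !mcoeff0. Qed.

Lemma kdownZ x c p : kdown x (c *: p) = c *: kdown x p.
Proof. by apply/mpolyP => m; rewrite !(mcoeffZ, mcoeff_kdown). Qed.

Lemma kdown_sum x (I : finType) (P : pred I) (F : I -> S) :
  kdown x (\sum_(i | P i) F i) = \sum_(i | P i) kdown x (F i).
Proof. exact: (big_morph _ (kdownD x) (kdown0 x)). Qed.

Lemma kdownX x y p :
  kdown x ('X_y * p) = if x == y then p else 'X_y * kdown x p.
Proof.
apply/mpolyP => m; rewrite mcoeff_kdown mcoeffXU_mul.
case: (x =P y) => [->|/eqP xy]; first by rewrite mnmDE mnm1E eqxx addn1 /= addmK.
rewrite mcoeffXU_mul mnmDE mnm1E (negbTE xy) addn0; case: ifPn => // my.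
rewrite mcoeff_kdown; congr (p@_ _); apply/mnmP => z.
rewrite !(mnmDE, mnmBE, mnm1E).
by case: (y =P z) => [<-|_]; rewrite ?(negbTE xy) ?subn0 ?addn0.
Qed.

Lemma ktotD f g t : ktot (fun s => f s + g s) t = ktot f t + ktot g t.
Proof.
by rewrite /ktot -big_split; apply: eq_bigr => x _ /=; rewrite mulrDr scalerDr.
Qed.

Lemma ktotB f g t : ktot (fun s => f s - g s) t = ktot f t - ktot g t.
Proof.
rewrite /ktot -sumrB; apply: eq_bigr => x _ /=.
by rewrite mulrBr scalerBr.
Qed.

Definition ksupp (i : nat) (f : {set 'I_n} -> S) : Prop :=
  forall s : {set 'I_n}, #|s| != i -> f s = 0.

Lemma ktot_supp i f : ksupp i.+1 f -> ksupp i (ktot f).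
Proof.
move=> hf s hs; rewrite /ktot big1 // => x xs.
by rewrite hf ?mulr0 ?scaler0 // cardsU1 xs.
Qed.

Lemma ktot_homotopy i (f : {set 'I_n} -> S) (y : 'I_n) :
    ksupp i f -> (forall t, ktot f t = 0) ->
  exists2 g : {set 'I_n} -> S, ksupp i.+1 g &
    forall t : {set 'I_n}, f t - ktot g t =
      if y \in t then 0 else f t - 'X_y * kdown y (f t).
Proof.
move=> hs hf.
exists (fun s : {set 'I_n} => if y \in s then ksign y (s :\ y) *: kdown y (f (s :\ y)) else 0).
  move=> s; case: ifP => // ys; rewrite (cardsD1 y s) ys => h.
  by rewrite hs ?kdown0 ?scaler0.
move=> t; case: ifPn => yt; last first.
  congr (_ - _); rewrite /ktot (bigD1 y) //= big1 ?addr0.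
    by rewrite setU11 setU1K // -scalerAr scalerA ksignK scale1r.
  move=> x /andP[xt xy].
  by rewrite !inE eq_sym (negbTE xy) (negbTE yt) /= mulr0 scaler0.
set r := t :\ y.
have yr : y \notin r by rewrite !inE eqxx.
have et : t = y |: r by rewrite setD1K.
have := congr1 (kdown y) (hf r).
rewrite kdown0 /ktot kdown_sum (bigD1 y) //= kdownZ kdownX eqxx -et => /eqP.
rewrite addrC addr_eq0 => /eqP h.
apply/eqP; rewrite subr_eq0; apply/eqP; symmetry.
rewrite (eq_bigl (fun x => (x \notin r) && (x != y))); last first.
  by move=> x; rewrite et !inE negb_or andbC.
rewrite (eq_bigr (fun x => (- ksign y r) *:
           kdown y (ksign x r *: ('X_x * f (x |: r))))).
  by rewrite -scaler_sumr h scalerN scaleNr opprK scalerA ksignK scale1r.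
move=> x /andP[xr xy]; rewrite et !inE eqxx orbT.
have -> : (x |: (y |: r)) :\ y = x |: r.
  apply/setP => z; rewrite !inE; case: (z =P y) => [->|] //=.
  by rewrite orbF eq_sym (negbTE xy).
rewrite kdownZ kdownX eq_sym (negbTE xy) -scalerAr !scalerA; congr (_ *: _).
rewrite !ksignU // mulrACA -exprD mulNr (mulrC (ksign y r)).
have [lt|lt|/val_inj e] := ltngtP x y; last by rewrite e eqxx in xy.
  by rewrite add0n expr1 mulN1r.
by rewrite addn0 expr1 mulN1r.
Qed.

Lemma ktot_exact i (f : {set 'I_n} -> S) :
    ksupp i f -> (forall t, ktot f t = 0) ->
  exists2 g : {set 'I_n} -> S, ksupp i.+1 g & forall (t : {set 'I_n}) m,
    (f t - ktot g t)@_m = if (t == set0) && (m == 0%MM) then (f t)@_m else 0.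
Proof.
move=> hs hf.
suff [g hg h] : exists2 g : {set 'I_n} -> S, ksupp i.+1 g & forall (t : {set 'I_n}) m,
    (f t - ktot g t)@_m =
    if has (fun y => (y \in t) || (m y != 0%N)) (enum 'I_n)
    then 0 else (f t)@_m.
  exists g => // t m; rewrite h.
  case: hasP => [[y _ hy]|hN].
    case: ifP => // /andP[/eqP et /eqP em].
    by move: hy; rewrite et em inE mnm0E.
  suff -> : (t == set0) && (m == 0%MM) by [].
  apply/andP; split; apply/eqP.
    apply/setP => y; rewrite inE; apply/negP => yt; apply: hN.
    by exists y; rewrite ?mem_enum ?yt.
  apply/mnmP => y; rewrite mnm0E; apply/eqP/negPn/negP => my; apply: hN.
  by exists y; rewrite ?mem_enum ?my ?orbT.
elim: (enum _) => [|y l [g hg h]].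
  exists (fun=> 0) => // t m; rewrite /= /ktot big1 ?subr0 // => x _.
  by rewrite mulr0 scaler0.
have hs' : ksupp i (fun t => f t - ktot g t).
  by move=> s si; rewrite hs // (ktot_supp hg) // subrr.
have hf' t : ktot (fun t => f t - ktot g t) t = 0.
  by rewrite ktotB hf ktotK subrr.
have [g' hg' h'] := ktot_homotopy y hs' hf'.
exists (fun s => g s + g' s) => [s si|t m].
  by rewrite hg // hg' // addr0.
rewrite ktotD opprD addrA h' /=.
case: ifPn => yt /=; first by rewrite mcoeff0.
rewrite mcoeffB mcoeffXU_mul mcoeff_kdown.
case: eqP => [my|/eqP my] /=; first by rewrite subr0 h.
by rewrite submK ?lep1mP // subrr.
Qed.

Definition kext (i : nat) (f : {ffun kgen i -> S}) (s : {set 'I_n}) : S :=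
  oapp f 0 (insub s).

Lemma kext_val i (f : {ffun kgen i -> S}) (s : kgen i) : kext f (val s) = f s.
Proof. by rewrite /kext valK. Qed.

Lemma kext_supp i (f : {ffun kgen i -> S}) : ksupp i (kext f).
Proof. by move=> s hs; rewrite /kext insubF //; apply/negbTE. Qed.

Lemma fbd_kext i (f : {ffun kgen i.+1 -> S}) (t : kgen i) :
  fbd (@kdiff i) f t = ktot (kext f) (val t).
Proof.
rewrite ffunE /kdiff.
transitivity (\sum_(s : kgen i.+1) \sum_(x | (x \notin val t) && (val s == x |: val t))
    ksign x (val t) *: ('X_x * f s)).
  apply: eq_bigr => s _; rewrite mulr_sumr.
  have e x : (x \in val s) && (val s :\ x == val t) =
             (x \notin val t) && (val s == x |: val t).
    apply/andP/andP => -[h1 /eqP h2].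
      by rewrite -h2 !inE eqxx setD1K.
    by rewrite h2 setU11 setU1K.
  rewrite (eq_bigl _ _ e); apply: eq_bigr => x /andP[xt /eqP ->].
  by rewrite ksignU // ltnn mul1r -scalerAr mulrC.
rewrite (exchange_big_dep (fun x => x \notin val t)) /=; last first.
  by move=> ? ? _ /andP[].
apply: eq_bigr => x xt.
have hc : #|x |: val t| == i.+1 by rewrite cardsU1 xt (eqP (valP t)).
rewrite (big_pred1 (Sub (x |: val t) hc)) => [|s]; last first.
  by rewrite /= xt -val_eqE.
by rewrite -kext_val.
Qed.

Lemma ktot_kext i (f : {ffun kgen i.+1 -> S}) t :
  kext (fbd (@kdiff i) f) t = ktot (kext f) t.
Proof.
have [/eqP ti|ti] := boolP (#|t| == i); last first.
  by rewrite kext_supp // (ktot_supp (@kext_supp _ f)).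
by move/eqP: ti => ti; rewrite -[t]/(val (Sub t ti : kgen i)) kext_val fbd_kext.
Qed.

Lemma kext_finfun i (g : {set 'I_n} -> S) : ksupp i g ->
  kext [ffun s : kgen i => g (val s)] =1 g.
Proof.
move=> hg s; have [hs|hs] := boolP (#|s| == i); last first.
  by rewrite kext_supp // hg.
by rewrite -[s]/(val (Sub s hs : kgen i)) kext_val ffunE.
Qed.

Lemma eq_ktot f g : f =1 g -> ktot f =1 ktot g.
Proof. by move=> e t; apply: eq_bigr => x _; rewrite e. Qed.

Lemma kset0 : #|(set0 : {set 'I_n})| == 0%N. Proof. by rewrite cards0. Qed.

Definition kdeg (i : nat) (s : kgen i) : nat := i.
Definition kaug (s : kgen 0) : K := 1.

Lemma kdiff_homog i (a : kgen i.+1) (b : kgen i) m :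
  m \in msupp (kdiff a b) -> (mdeg m + kdeg b)%N = kdeg a.
Proof.
rewrite mcoeff_msupp /kdiff raddf_sum /=; apply: contraNeq => hm.
rewrite big1 // => x _; rewrite mcoeffZ mcoeffX.
by case: (U_(x)%MM =P m) hm => [<-|]; rewrite ?mulr0 // mdeg1 add1n eqxx.
Qed.

Lemma kexact0 (f : {ffun kgen 0 -> S}) :
  \sum_b (f b)@_0%MM * kaug b = 0 <-> exists g, f = fbd (@kdiff 0) g.
Proof.
have -> : \sum_b (f b)@_0%MM * kaug b = (kext f set0)@_0%MM.
  rewrite (big_pred1 (Sub set0 kset0)) => [|s]; last first.
    by rewrite /= -val_eqE /= -cards_eq0 (valP s).
  by rewrite mulr1 -kext_val.
have kf0 t : ktot (kext f) t = 0.
  rewrite /ktot big1 // => x xt.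
  by rewrite kext_supp ?mulr0 ?scaler0 // cardsU1 xt.
split=> [f0|[g ->]].
  have [g hg h] := ktot_exact (@kext_supp _ f) kf0.
  exists [ffun s => g (val s)]; apply/ffunP => t.
  rewrite fbd_kext (eq_ktot (kext_finfun hg)) -kext_val.
  apply/eqP; rewrite -subr_eq0; apply/eqP/mpolyP => m; rewrite h mcoeff0.
  by case: ifP => // /andP[/eqP -> /eqP ->].
rewrite ktot_kext /ktot raddf_sum big1 //= => x _.
by rewrite mcoeffZ mcoeffXU_mul mnm0E eqxx mulr0.
Qed.

Lemma kexactS i (f : {ffun kgen i.+1 -> S}) :
  fbd (@kdiff i) f = 0 <-> exists g, f = fbd (@kdiff i.+1) g.
Proof.
split=> [f0|[g ->]].
  have kf0 t : ktot (kext f) t = 0.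
    by rewrite -ktot_kext f0 /kext; case: insub => //= s; rewrite ffunE.
  have [g hg h] := ktot_exact (@kext_supp _ f) kf0.
  exists [ffun s => g (val s)]; apply/ffunP => t.
  rewrite fbd_kext (eq_ktot (kext_finfun hg)) -kext_val.
  apply/eqP; rewrite -subr_eq0; apply/eqP/mpolyP => m; rewrite h mcoeff0.
  case: ifP => // /andP[/eqP e _]; rewrite e.
  by rewrite kext_supp ?mcoeff0 // cards0.
apply/ffunP => t; rewrite fbd_kext (eq_ktot (ktot_kext g)) ktotK.
by rewrite ffunE.
Qed.

Lemma kaug_homog (b : kgen 0) : kaug b != 0 -> kdeg b = 0%N.
Proof. by []. Qed.

Lemma kaug_surj : exists b, kaug b != 0.
Proof. by exists (Sub set0 kset0); rewrite oner_eq0. Qed.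

Definition koszul : residue_resolution K n :=
  ResidueResolution kdiff_homog kaug_homog kaug_surj kexact0 kexactS.
End Koszul.

(** [betti J i j] is the graded Betti number dim_K Tor_i^S(J, K)_j. *)
Definition betti (K : fieldType) (n : nat) (J : {mpoly K[n]} -> Prop)
  (i j : nat) : nat := tor_dim (koszul K n) J i j.

(** [tor_dim], hence [betti], is indeed the dimension of Tor when [J] is an
    ideal. *)
Section FiniteDimension.
Variables (K : fieldType) (n : nat).

Definition subspace (U : lmodType K) (Z : U -> Prop) : Prop :=
  Z 0 /\ forall a u v, Z u -> Z v -> Z (a *: u + v).

Lemma subspace_sum (U : lmodType K) (Z : U -> Prop) (I : finType)
    (c : I -> K) (v : I -> U) :
  subspace Z -> (forall i, Z (v i)) -> Z (\sum_i c i *: v i).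
Proof.
move=> [Z0 ZD] Zv; elim/big_ind: _ => // [x y Zx Zy|i _].
  by rewrite -[x]scale1r; apply: ZD.
by rewrite -[_ *: _]addr0; apply: ZD.
Qed.

Lemma subspaceZ (U : lmodType K) (Z : U -> Prop) a u :
  subspace Z -> Z u -> Z (a *: u).
Proof. by move=> [Z0 ZD] Zu; rewrite -[_ *: _]addr0; apply: ZD. Qed.

Lemma subquot_dim_exists (U : lmodType K) (Z B : U -> Prop) (N : nat)
    (phi : U -> 'rV[K]_N) :
    (forall a u v, phi (a *: u + v) = a *: phi u + phi v) ->
    (forall z, Z z -> phi z = 0 -> z = 0) ->
    subspace Z -> subspace B ->
  exists d, subquot_dim Z B d.
Proof.
move=> phiD phi_inj sZ sB.
pose indep d := exists v : 'I_d -> U, (forall i, Z (v i)) /\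
  forall c : 'rV[K]_d, B (\sum_i c 0 i *: v i) -> c = 0.
have phi0 : phi 0 = 0 by rewrite -[0 in LHS](addNr 0) -scaleN1r phiD scaleN1r addNr.
have indep_le d : indep d -> (d <= N)%N.
  move=> [v [Zv iv]]; rewrite leqNgt; apply/negP => lt.
  pose M := \matrix_(i < d) phi (v i).
  have : kermx M != 0.
    rewrite kermx_eq0; apply/negP => /eqP r.
    by have := rank_leq_col M; rewrite r leqNgt lt.
  case/rowV0Pn => c /sub_kermxP cM; case/negP; apply/eqP; apply: iv.
  suff -> : \sum_i c 0 i *: v i = 0 by case: sB.
  apply: phi_inj; first exact: subspace_sum.
  have phiS (r : seq 'I_d) :
      phi (\sum_(i <- r) c 0 i *: v i) = \sum_(i <- r) c 0 i *: phi (v i).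
    by elim: r => [|i r IH]; rewrite ?big_nil ?big_cons // phiD IH.
  rewrite phiS -[RHS]cM mulmx_sum_row; apply: eq_bigr => i _.
  by rewrite rowK.
have [d [id maxd]] : exists d, indep d /\ ~ indep d.+1.
  have i0 : indep 0%N.
    by exists (fun=> 0); split=> [[]//|c _]; apply/rowP => -[].
  apply: NNPP => h.
  have all d : indep d.
    by elim: d => // d IH; apply: NNPP => hd; apply: h; exists d.
  by have := indep_le _ (all N.+1); rewrite ltnn.
have [v [Zv iv]] := id; exists d, v; split=> // z Zz.
have [B0 BD] := sB.
have [[c Bc]|hN] := classic (exists c : 'rV[K]_d, B (z - \sum_i c 0 i *: v i)).
  exists c; split=> // c' Bc'; apply/eqP; rewrite -subr_eq0; apply/eqP/iv.
  have -> : \sum_i (c - c') 0 i *: v i =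
      -1 *: (z - \sum_i c 0 i *: v i) + (z - \sum_i c' 0 i *: v i).
    rewrite scaleN1r opprB addrA subrK -sumrB; apply: eq_bigr => i _.
    by rewrite !mxE scalerBl.
  exact: BD.
case: maxd; exists (fun i => oapp v z (unlift ord0 i)); split.
  by move=> i; case: (unlift ord0 i).
move=> c; rewrite big_ord_recl unlift_none /=.
rewrite (eq_bigr (fun i => c 0 (fintype.lift ord0 i) *: v i)); last first.
  by move=> i _; rewrite liftK.
have [c0|c0] := eqVneq (c 0 ord0) 0.
  rewrite c0 scale0r add0r => h.
  have c' : (\row_i c 0 (fintype.lift ord0 i)) = 0 :> 'rV[K]_d.
    by apply: iv; under eq_bigr do rewrite mxE.
  apply/rowP => i; rewrite [RHS]mxE; case: (unliftP ord0 i) => [k ->|->//].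
  by move/rowP/(_ k): c'; rewrite !mxE.
move=> h; case: hN; exists (\row_i (- ((c 0 ord0)^-1 * c 0 (fintype.lift ord0 i)))).
have := subspaceZ (c 0 ord0)^-1 sB h.
rewrite scalerDr scalerA mulVf // scale1r scaler_sumr -sumrN.
congr (B (_ + _)); apply: eq_bigr => i _.
by rewrite mxE scaleNr opprK scalerA.
Qed.

Definition is_ideal (J : {mpoly K[n]} -> Prop) : Prop :=
  [/\ J 0, forall f g, J f -> J g -> J (f + g) & forall f g, J g -> J (f * g)].

Lemma tor_chain_subspace (F : residue_resolution K n) J i j :
  is_ideal J -> subspace (@tor_chain K n F J i j).
Proof.
move=> [J0 JD JM]; split=> [b|a f g hf hg b]; rewrite !ffunE.
  by split=> // m; rewrite msupp0.
have [Jf df] := hf b; have [Jg dg] := hg b; split.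
  by apply: (JD _ _ _ Jg); rewrite -mul_mpolyC; apply: JM.
move=> m; rewrite mcoeff_msupp mcoeffD mcoeffZ => h.
have [f0|f0] := eqVneq (f b)@_m 0; last by apply: df; rewrite mcoeff_msupp.
by apply: dg; move: h; rewrite f0 mulr0 add0r mcoeff_msupp.
Qed.

Lemma fbd_linear (A B : finType) (M : A -> B -> {mpoly K[n]}) a f g :
  fbd M (a *: f + g) = a *: fbd M f + fbd M g.
Proof.
apply/ffunP => b; rewrite !ffunE scaler_sumr -big_split; apply: eq_bigr => c _.
by rewrite !ffunE mulrDl scalerAl.
Qed.

Lemma fbd0 (A B : finType) (M : A -> B -> {mpoly K[n]}) : fbd M 0 = 0.
Proof.
by apply/ffunP => b; rewrite !ffunE big1 // => a _; rewrite ffunE mul0r.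
Qed.

Lemma closed_chain_subspace (F : residue_resolution K n) i :
  subspace (@closed_chain K n F i).
Proof.
case: i => [|i] //; split=> [|a u v]; rewrite /closed_chain; first exact: fbd0.
by move=> hu hv; rewrite fbd_linear hu hv scaler0 addr0.
Qed.

Lemma tor_dimP (F : residue_resolution K n) J i j : is_ideal J ->
  subquot_dim (@tor_cycle K n F J i j) (@tor_boundary K n F J i j)
    (tor_dim F J i j).
Proof.
move=> hJ; rewrite /tor_dim; apply: epsilon_spec.
pose T : finType := (fgen F i * 'X_{1..n < j.+1})%type.
pose phi (f : {ffun fgen F i -> {mpoly K[n]}}) : 'rV[K]_#|T| :=
  \row_(k < #|T|) (f (enum_val k : T).1)@_(enum_val k : T).2.
apply: (@subquot_dim_exists _ _ _ _ phi).
- move=> a u v; apply/rowP => k.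
  by rewrite !mxE !ffunE mcoeffD mcoeffZ.
- move=> z [hz _] /rowP z0; apply/ffunP => b; rewrite ffunE.
  apply/mpolyP => m; rewrite mcoeff0.
  have [hm|] := boolP (m \in msupp (z b)); last by rewrite mcoeff_msupp negbK => /eqP.
  have lt : (mdeg m < j.+1)%N by rewrite ltnS -((hz b).2 m hm) leq_addr.
  by have := z0 (enum_rank ((b, BMultinom lt) : T)); rewrite !mxE enum_rankK.
- have [C0 CD] := @tor_chain_subspace F J i j hJ.
  have [c0 cD] := closed_chain_subspace F i.
  by split=> [|a u v [Cu cu] [Cv cv]]; split=> //; [exact: CD | exact: cD].
- have [C0 CD] := @tor_chain_subspace F J i.+1 j hJ.
  split=> [|a _ _ [u Cu ->] [v Cv ->]].
    by exists 0; rewrite ?fbd0.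
  by exists (a *: u + v); rewrite ?fbd_linear //; apply: CD.
Qed.

Lemma bettiP (J : {mpoly K[n]} -> Prop) i j : is_ideal J ->
  subquot_dim (@tor_cycle K n (koszul K n) J i j)
    (@tor_boundary K n (koszul K n) J i j) (betti J i j).
Proof. exact: tor_dimP. Qed.
End FiniteDimension.

Section Index.
Variables (K : fieldType) (n : nat) (J : {mpoly K[n]} -> Prop).

Definition steps_linear (r : nat) : Prop :=
  exists d : nat, [/\ exists2 f, J f & f != 0, generated_in_degree J d &
    forall i j, (i <= r)%N -> (d < j)%N -> betti J i (i + j) = 0%N].

(** Supremum in N together with +oo (encoded by [None]) of a nonempty set. *)
Definition is_sup_nat (A : nat -> Prop) (s : option nat) : Prop :=
  (exists r, A r) /\
  match s with
  | Some s => (forall r, A r -> (r <= s)%N) /\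
              forall u, (forall r, A r -> (r <= u)%N) -> (s <= u)%N
  | None => forall u, exists2 r, A r & (u < r)%N
  end.

Definition linear_index : option nat :=
  omap succn (epsilon (inhabits None) (is_sup_nat steps_linear)).
End Index.

Section Graphs.
Variables (n : nat) (e : rel 'I_n).

Definition edge_ideal (K : fieldType) : {mpoly K[n]} -> Prop :=
  ideal_gen (fun f => exists i j, e i j /\ f = 'X_i * 'X_j).

Definition edges : {set {set 'I_n}} :=
  [set [set p.1; p.2] | p : 'I_n * 'I_n & e p.1 p.2].

Definition is_matching (M : {set {set 'I_n}}) : bool :=
  (M \subset edges) && trivIset M.

Definition is_gap (a b : {set 'I_n}) : bool :=
  [disjoint a & b] &&
  ~~ [exists f in edges, (a :&: f != set0) && (b :&: f != set0)].

Definition restricted_matching (M : {set {set 'I_n}}) : bool :=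
  is_matching M && [exists a in M, forall b in M, (b != a) ==> is_gap a b].

Definition restricted_matching_number : nat :=
  if [exists M, restricted_matching M]
  then \max_(M | restricted_matching M) #|M| else 1%N.
End Graphs.
Arguments edge_ideal {n} e K _.

(* Main.v *)
Require Import Defs.
From mathcomp Require Import all_boot all_algebra.
From mathcomp Require mpoly.
From Stdlib Require Import ClassicalEpsilon.

(** Take an edge [a = {p, q}] forming a gap with each of [k] pairwise disjoint
    edges, let [N] be the set of these edges and [V] the set of the [2k + 2]
    vertices involved.  In the graph induced on [V] the edge [a] is a connected
    component, so a generator of [I^[k]] dividing [x_V] either avoids [a]
    altogether, and is then the product of the vertices of [N], or is divisible
    by [x_p x_q].  The first generator and any of the others have lcm [x_V], so
    their syzygy in multidegree [x_V] is minimal, and it lives in degree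
    [2k + 2], above the linear strand. *)

Set Implicit Arguments.
Unset Strict Implicit.
Unset Printing Implicit Defensive.

Import GRing.Theory.

(** * Monomial ideals and their minimal generators *)

Section MonomialIdeals.
Import mpoly.
Local Open Scope ring_scope.
Variables (K : fieldType) (n : nat).
Implicit Types (m : 'X_{1..n}) (f : {mpoly K[n]}).

Lemma ideal_gen_is_ideal (A : {mpoly K[n]} -> Prop) : is_ideal (ideal_gen A).
Proof.
split=> [|f g [s sA ->] [t tA ->]|f g [s sA ->]].
- by exists [::] => //; rewrite big_nil.
- exists (s ++ t); last by rewrite big_cat.
  by move=> p; rewrite mem_cat => /orP[/sA|/tA].
exists [seq (f * p.1, p.2) | p <- s]; first by move=> _ /mapP[p /sA ? ->].
by rewrite big_map mulr_sumr; apply: eq_bigr => p _; rewrite mulrA.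
Qed.

Lemma mem_ideal_gen (A : {mpoly K[n]} -> Prop) a : A a -> ideal_gen A a.
Proof.
move=> Aa; exists [:: (1, a)]; last by rewrite big_seq1 mul1r.
by move=> p; rewrite inE => /eqP->.
Qed.

(** Serves as an induction principle: to prove a property of a generated ideal, [L] is taken to be
    the set of polynomials having it. *)
Lemma ideal_gen_min (A L : {mpoly K[n]} -> Prop) : is_ideal L ->
  (forall a, A a -> L a) -> forall f, ideal_gen A f -> L f.
Proof.
move=> [L0 LD LM] AL _ [s sA ->]; rewrite big_seq.
by elim/big_ind: _ => // p ps; apply/LM/AL/sA.
Qed.

(** The polynomials all of whose monomials are divisible by some element of [A] form an ideal
    containing the generators. *)
Lemma msupp_monomial_ideal (A : 'X_{1..n} -> Prop) f m :
  monomial_ideal A f -> m \in msupp f -> exists2 a, A a & (a <= m)%MM.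
Proof.
move=> Jf; move: f Jf m.
apply: ideal_gen_min; first split=> [m|f g hf hg m|f g hg m].
- by rewrite msupp0.
- by move/msuppD_le; rewrite mem_cat => /orP[/hf|/hg].
- move/msuppM_le/allpairsP=> [[m1 m2] /= [_ /hg[a Aa am] ->]].
  by exists a => //; apply: lepm_trans am (lem_addl _ _).
by move=> _ [a Aa ->] m; rewrite msuppX inE => /eqP->; exists a; rewrite ?lepm_refl.
Qed.

Lemma monomial_idealX (A : 'X_{1..n} -> Prop) a m :
  A a -> (a <= m)%MM -> @monomial_ideal K n A 'X_[m].
Proof.
move=> Aa /submK <-; rewrite mpolyXD.
have [_ _] := ideal_gen_is_ideal (fun f => exists2 m, A m & f = 'X_[K, m]).
by apply; apply: mem_ideal_gen; exists a.
Qed.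

Lemma lem_mdeg_eq m1 m2 : (m1 <= m2)%MM -> mdeg m1 = mdeg m2 -> m1 = m2.
Proof.
move=> le12; have <- := submK le12; rewrite mdegD -{1}[mdeg m1]add0n => /addIn/esym/eqP.
by rewrite mdeg_eq0 => /eqP ->; rewrite add0m.
Qed.

(** Divisibility between monomials of one degree is equality. If [B] also generates [J] and [a] is
    in [A], some [b] of [B] divides [a] and some [c] of [A] divides [b]; then [c = a], hence
    [b = a]. So [A] lies in every such [B]. *)
Lemma min_mon_gens_equigenerated (A : 'X_{1..n} -> Prop) d
    (J : {mpoly K[n]} -> Prop) m :
  (forall f, J f <-> monomial_ideal A f) -> (forall a, A a -> mdeg a = d) ->
  min_mon_gens J m <-> A m.
Proof.
move=> JA dA.
have sub (B : 'X_{1..n} -> Prop) a :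
    (forall f, J f <-> monomial_ideal B f) -> A a -> exists2 b, B b & (b <= a)%MM.
  move=> JB Aa; apply: (@msupp_monomial_ideal B 'X_[a]); last by rewrite msuppX mem_head.
  by apply/JB/JA/(monomial_idealX Aa)/lepm_refl.
have minA (B : 'X_{1..n} -> Prop) a :
    (forall f, J f <-> monomial_ideal B f) -> A a -> B a.
  move=> JB Aa; have [b Bb ba] := sub B a JB Aa.
  have [c Ac cb] : exists2 c, A c & (c <= b)%MM.
    apply: (@msupp_monomial_ideal A 'X_[b]); last by rewrite msuppX mem_head.
    by apply/JA/JB/(monomial_idealX Bb)/lepm_refl.
  have ca := lem_mdeg_eq (lepm_trans cb ba) (etrans (dA c Ac) (esym (dA a Aa))).
  suff -> : a = b by [].
  by apply/mnmP => i; apply/eqP; rewrite eqn_leq -{1}ca (mnm_lepP cb) (mnm_lepP ba).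
split=> [[B [JB minB] Bm]|Am].
  by apply: minB Bm => // a Aa; apply: minA.
by exists A => //; split=> // B _ JB a; apply: minA.
Qed.

End MonomialIdeals.

(** * Monomial generators of the powers of the edge ideal *)

Section EdgeProducts.
Import mpoly.
Local Open Scope ring_scope.
Variables (K : fieldType) (n : nat) (e : rel 'I_n).

(** Edges may repeat, so these monomials generate the ordinary power [I^k]; squarefreeness is
    imposed separately. *)
Definition edge_product (k : nat) (m : 'X_{1..n}) : Prop :=
  exists s : seq ('I_n * 'I_n),
    [/\ size s = k, all (fun p => e p.1 p.2) s
      & m = (\sum_(p <- s) (U_(p.1) + U_(p.2)))%MM].

Lemma mdeg_edge_product k m : edge_product k m -> mdeg m = k.*2.
Proof.
move=> [s [<- _ ->]]; rewrite mdeg_sum.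
under eq_bigr do rewrite mdegD !mdeg1.
by rewrite big_const_seq count_predT iter_addn addn0 mul2n.
Qed.

Lemma edge_product_cons k m i j :
  e i j -> edge_product k m -> edge_product k.+1 (U_(i) + U_(j) + m)%MM.
Proof.
move=> eij [s [<- es ->]]; exists ((i, j) :: s).
by split=> //=; rewrite ?eij // big_cons.
Qed.

Lemma ideal_pow_edge_ideal k f :
  ideal_pow (edge_ideal e K) k f <-> monomial_ideal (edge_product k) f.
Proof.
(* For fixed [g] these [f] form the colon ideal [L : g], so membership of a product can be checked
   on generators, one factor at a time. *)
have idealM (L : {mpoly K[n]} -> Prop) g : is_ideal L -> is_ideal (fun f => L (f * g)).
  move=> [L0 LD LM]; split=> [|f1 f2|f1 f2 h]; first by rewrite mul0r.
    by rewrite mulrDl; apply: LD.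
  by rewrite -mulrA; apply: LM.
have gensI (A : {mpoly K[n]} -> Prop) := ideal_gen_is_ideal A.
elim: k f => [|k IH] f.
  split=> // _; have [_ _ JM] := gensI (fun f => exists2 m, edge_product 0 m & f = 'X_[K, m]).
  rewrite -[f]mulr1; apply: JM; apply: mem_ideal_gen; exists 0%MM; last by rewrite mpolyX0.
  by exists [::]; rewrite big_nil.
split; apply: (ideal_gen_min (gensI _)).
  move=> _ [{}f [g [If /IH Jg ->]]].
  have I1 := idealM (monomial_ideal (edge_product k.+1)) g (gensI _).
  apply: (ideal_gen_min I1) If => _ [i [j [eij ->]]].
  rewrite mulrC.
  have I2 := idealM (monomial_ideal (edge_product k.+1)) ('X_i * 'X_j) (gensI _).
  apply: (ideal_gen_min I2) Jg => _ [m km ->].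
  rewrite mulrC -!mpolyXD; apply: monomial_idealX (lepm_refl _).
  exact: edge_product_cons.
move=> _ [_ [s [sk es ->]] ->]; case: s sk es => // [[i j] s] [sk] /andP[eij es].
rewrite big_cons /=; apply: mem_ideal_gen.
exists ('X_i * 'X_j), 'X_[\sum_(p <- s) (U_(p.1) + U_(p.2))].
split; last by rewrite !mpolyXD.
  by apply: mem_ideal_gen; exists i, j.
by apply/IH; apply: monomial_idealX (lepm_refl _); exists s.
Qed.

Lemma min_mon_gens_edge_ideal_pow k m :
  min_mon_gens (ideal_pow (edge_ideal e K) k) m <-> edge_product k m.
Proof.
apply: min_mon_gens_equigenerated (@mdeg_edge_product k) => f.
exact: ideal_pow_edge_ideal.
Qed.

End EdgeProducts.

(** * Koszul homology in homological degrees 0 and 1 *)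

Section BettiNumbers.
Import mpoly.
Local Open Scope ring_scope.
Variables (K : fieldType) (n : nat).
Implicit Types (m : 'X_{1..n}) (V : {set 'I_n}).

(** When every element of [Z] lies in [B], each coefficient vector represents [0]; uniqueness then
    leaves room for the zero vector space only. *)
Lemma subquot_dim_eq0 (U : lmodType K) (Z B : U -> Prop) d :
  Z 0 -> subspace B -> (forall z, Z z -> B z) -> subquot_dim Z B d -> d = 0%N.
Proof.
move=> Z0 sB ZB [v [Zv uv]]; have [c [_ cP]] := uv 0 Z0.
have all_c (c' : 'rV[K]_d) : c = c'.
  apply: cP; rewrite sub0r -scaleN1r; apply: subspaceZ => //.
  by apply: subspace_sum => // i; apply: ZB.
case: d {v Zv uv cP} c all_c => // d c all_c.
have /rowP/(_ 0) := etrans (esym (all_c 0)) (all_c (const_mx 1)).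
by rewrite !mxE => /esym/eqP; rewrite oner_eq0.
Qed.

Lemma subquot_dim0 (U : lmodType K) (Z B : U -> Prop) z :
  subquot_dim Z B 0 -> Z z -> B z.
Proof. by move=> [v [_ uv]] /uv[c []]; rewrite big_ord0 subr0. Qed.

Lemma tor_boundary_subspace (F : residue_resolution K n) J i j :
  is_ideal J -> subspace (@tor_boundary K n F J i j).
Proof.
move=> hJ; have [C0 CD] := @tor_chain_subspace K n F J i.+1 j hJ.
split=> [|a _ _ [u Cu ->] [v Cv ->]]; first by exists 0; rewrite ?fbd0.
by exists (a *: u + v); rewrite ?fbd_linear //; apply: CD.
Qed.

Lemma ksign0 (x : 'I_n) : ksign K x set0 = 1.
Proof.
rewrite /ksign (_ : [set y in _ | _] = set0) ?cards0 //.
by apply/setP => y; rewrite !inE.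
Qed.

(** A monomial of the ideal [J] of degree above [d] is a variable times another monomial of [J], so
    it vanishes in [J / (x_1, ..., x_n) J], which is Tor in degree 0. *)
Lemma betti0_eq0 (A : 'X_{1..n} -> Prop) d j :
  (forall a, A a -> mdeg a = d) -> (d < j)%N ->
  betti (@monomial_ideal K n A) 0 j = 0%N.
Proof.
move=> dA lt_dj.
have idJ := ideal_gen_is_ideal (fun f => exists2 m, A m & f = 'X_[K, m]).
have sB := @tor_boundary_subspace (koszul K n) _ 0 j idJ.
apply: (subquot_dim_eq0 _ sB _ (bettiP 0 j idJ)).
  by split=> //; case: (tor_chain_subspace (koszul K n) 0 j idJ).
move=> f [Cf _].
(* The empty face [b0] is the only basis element in homological degree 0, so a chain is a single
   polynomial and splits into monomials. *)
pose g m : {ffun kgen n 0 -> {mpoly K[n]}} := [ffun=> 'X_[m]].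
pose b0 : kgen n 0 := Sub set0 (@kset0 n).
have b0P (b : kgen n 0) : b = b0 by apply/val_inj/cards0_eq/eqP/(valP b).
have -> : f = \sum_(m <- msupp (f b0)) (f b0)@_m *: g m.
  apply/ffunP => b; rewrite (b0P b) {1}[f b0]mpolyE sum_ffunE.
  by apply: eq_bigr => m _; rewrite !ffunE.
rewrite big_seq; have [B0 BD] := sB; elim/big_ind: _ => // [x y Bx By|m mf].
  by rewrite -[x]scale1r; apply: BD.
apply: subspaceZ => //.
have [Jf df] := Cf b0; have dm : mdeg m = j by rewrite -(df m mf) addn0.
have [a Aa am] := msupp_monomial_ideal Jf mf.
(* The degree of [a] is below that of [m], so some exponent is strictly smaller. *)
have [x] : exists x, (a x < m x)%N.
  apply/existsP; apply: contraTT lt_dj; rewrite negb_exists => /forallP ma.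
  rewrite -dm -(dA a Aa) !mdegE -leqNgt; apply: leq_sum => x _.
  by rewrite leqNgt ma.
move=> lt_x.
(* The monomial [m / x], still divisible by [a], placed on the face [{x}] has boundary [m]. *)
pose h s : {mpoly K[n]} := if s == [set x] then 'X_[m - U_(x)] else 0.
have hsupp : ksupp 1 h.
  by move=> s; rewrite /h; case: (s =P _) => // ->; rewrite cards1.
exists [ffun s : kgen n 1 => h (val s)].
  move=> s; rewrite ffunE /h; case: eqP => _; last first.
    by split=> [|m']; [case: idJ | rewrite msupp0].
  split.
    apply: monomial_idealX Aa _; apply/mnm_lepP => y; rewrite mnmBE mnm1E.
    case: eqP => [<-|_]; first by rewrite subn1 -ltnS prednK // (leq_trans _ lt_x).
    by rewrite subn0 (mnm_lepP am).
  move=> m'; rewrite msuppX inE => /eqP -> /=.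
  by rewrite -dm -[in RHS](@submK _ U_(x) m) ?mdegD ?mdeg1 // lep1mP -lt0n (leq_trans _ lt_x).
apply/ffunP => t; rewrite fbd_kext (eq_ktot (kext_finfun hsupp)) ffunE (b0P t) /=.
rewrite /ktot (bigD1 x) ?inE //= big1 ?addr0 => [|y /andP[_ yx]].
  rewrite setU0 /h eqxx.
  rewrite ksign0 scale1r -mpolyXD addmC submK // lep1mP -lt0n.
  exact: leq_ltn_trans lt_x.
by rewrite setU0 /h (inj_eq set1_inj) (negbTE yx) mulr0 scaler0.
Qed.

Lemma mesym1U x V : x \in V -> mesym1 V = (U_(x) + mesym1 (V :\ x))%MM.
Proof.
move=> xV; apply/mnmP => y; rewrite mnmDE mnm1E !mnmE !inE eq_sym.
by case: eqP => [->|_]; rewrite ?xV.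
Qed.

(** The face [{x, p}] enters the coefficient at [V - p] through its own coefficient at [V - p - x],
    and not at all for [x] outside [V]. The hypothesis kills every remaining [x] except [q]. *)
Lemma ktot1_mcoeff (g : {set 'I_n} -> {mpoly K[n]}) V p q :
  p != q -> q \in V ->
  (forall x, x \in V -> x != p -> x != q ->
     (g (x |: [set p]))@_(mesym1 (V :\ p :\ x)) = 0) ->
  (ktot g [set p])@_(mesym1 (V :\ p)) =
    ksign K q [set p] * (g [set q; p])@_(mesym1 (V :\ p :\ q)).
Proof.
move=> pq qV g0.
have term x : (ksign K x [set p] *: ('X_x * g (x |: [set p])))@_(mesym1 (V :\ p)) =
    if x \in V :\ p then ksign K x [set p] * (g (x |: [set p]))@_(mesym1 (V :\ p :\ x))
    else 0.
  rewrite mcoeffZ mcoeffXU_mul mnmE; case: (boolP (x \in V :\ p)) => [xV|_] /=.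
    by rewrite (mesym1U xV) addmC addmK.
  by rewrite mulr0.
rewrite raddf_sum /= (bigD1 q) ?inE 1?eq_sym //= big1 ?addr0 => [|x /andP[xp xq]].
  by rewrite term !inE eq_sym pq qV.
rewrite term; case: ifP => //; rewrite !inE => /andP[xp' xV].
by rewrite g0 ?mulr0.
Qed.

Lemma ksign1_antisym (p q : 'I_n) : p != q -> ksign K q [set p] = - ksign K p [set q].
Proof.
move=> pq; have := @ksignUC K n p q set0 pq; rewrite !inE !setU0 !ksign0 !mul1r.
by move=> ->.
Qed.

(** In the squarefree multidegree of [V], Koszul boundaries in homological
    degree 1 are killed by the sum of the [p]- and [q]-coordinates: only the
    face [{p, q}] contributes, with opposite signs.  The cycle relating
    [V - p] to [V - z] is not. *)
Lemma betti1_neq0 (A : 'X_{1..n} -> Prop) V p q z :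
  p \in V -> q \in V -> z \in V -> p != q -> z != p -> z != q ->
  @monomial_ideal K n A 'X_[mesym1 (V :\ p)] ->
  @monomial_ideal K n A 'X_[mesym1 (V :\ z)] ->
  (forall a x, A a -> x \in V -> x != p -> x != q ->
     ~~ (a <= mesym1 (V :\ p :\ x))%MM && ~~ (a <= mesym1 (V :\ q :\ x))%MM) ->
  betti (@monomial_ideal K n A) 1 #|V| != 0%N.
Proof.
move=> pV qV zV pq zp zq Jp Jz NA.
have idJ := ideal_gen_is_ideal (fun f => exists2 m, A m & f = 'X_[K, m]).
apply/negP => /eqP b0; have := bettiP 1 #|V| idJ; rewrite [betti _ _ _]b0 => bt.
(* The cycle [x_{V-p} e_p - x_{V-z} e_z]: its differential is [x_V - x_V]. *)
pose h (s : {set 'I_n}) : {mpoly K[n]} :=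
  if s == [set p] then 'X_[mesym1 (V :\ p)]
  else if s == [set z] then - 'X_[mesym1 (V :\ z)] else 0.
have hsupp : ksupp 1 h.
  move=> s; rewrite /h; case: (s =P _) => [->|_]; first by rewrite cards1.
  by case: (s =P _) => [->|//]; rewrite cards1.
pose f : {ffun kgen n 1 -> {mpoly K[n]}} := [ffun s => h (val s)].
have card_V x : x \in V -> (#|V :\ x| + 1)%N = #|V|.
  by move=> xV; rewrite (cardsD1 x V) xV addnC.
have [] := subquot_dim0 (z := f) bt.
  split.
    move=> b; rewrite ffunE /h; case: eqP => _.
      split=> // m; rewrite msuppX inE => /eqP ->.
      by rewrite mdeg_mesym1 /= /kdeg card_V.
    case: eqP => _; last by split=> [|m]; [case: idJ | rewrite msupp0].
    split=> [|m]; first by case: idJ => _ _ JM; rewrite -mulN1r; apply: JM.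
    by rewrite (perm_mem (msuppN _)) msuppX inE => /eqP ->; rewrite mdeg_mesym1 /= /kdeg card_V.
  apply/ffunP => t; rewrite fbd_kext (eq_ktot (kext_finfun hsupp)) ffunE.
  have /eqP -> : val t == set0 by rewrite -cards_eq0; apply: (valP t).
  rewrite /ktot (bigD1 p) ?inE //= (bigD1 z) ?inE //= big1 => [|x /andP[/andP[_ xp] xz]].
    rewrite !setU0 !ksign0 !scale1r /h eqxx !(inj_eq set1_inj) (negbTE zp) eqxx.
    by rewrite mulrN -!mpolyXD -!mesym1U // addr0 subrr.
  by rewrite setU0 /h !(inj_eq set1_inj) (negbTE xp) (negbTE xz) mulr0 scaler0.
move=> g Cg fg.
have gJ s : monomial_ideal A (kext g s).
  rewrite /kext; case: insubP => [b _ _|_] /=; last by case: idJ.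
  by have [] := Cg b.
have kf s : h s = ktot (kext g) s by rewrite -(kext_finfun hsupp) -/f fg ktot_kext.
(* Coordinates of [g] lie in the monomial ideal, so their coefficients vanish at monomials that no
   generator divides. *)
have g0 s x : x \in V -> x != p -> x != q ->
    (kext g s)@_(mesym1 (V :\ p :\ x)) = 0 /\ (kext g s)@_(mesym1 (V :\ q :\ x)) = 0.
  move=> xV xp xq; split; apply: memN_msupp_eq0; apply/negP;
    move/(msupp_monomial_ideal (gJ s)) => [a /NA/(_ xV xp xq)/andP[]].
    by move=> /negbTE ->.
  by move=> _ /negbTE ->.
have Ep := ktot1_mcoeff pq qV (fun x xV xp xq => (g0 (x |: [set p]) x xV xp xq).1).
have Eq : (ktot (kext g) [set q])@_(mesym1 (V :\ q)) =
    ksign K p [set q] * (kext g [set p; q])@_(mesym1 (V :\ q :\ p)).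
  apply: ktot1_mcoeff => // [|x xV xq xp]; first by rewrite eq_sym.
  exact: (g0 _ _ xV xp xq).2.
(* The contributions of [{p, q}] cancel, whereas the sum for [h] is [1], since [q] is neither [p]
   nor [z]. *)
have : (h [set p])@_(mesym1 (V :\ p)) + (h [set q])@_(mesym1 (V :\ q)) = 0.
  rewrite !kf Ep Eq ksign1_antisym // setUC.
  have -> : V :\ p :\ q = V :\ q :\ p by rewrite !setDDl setUC.
  by rewrite mulNr addNr.
rewrite /h eqxx !(inj_eq set1_inj) eq_sym (negbTE pq) eq_sym (negbTE zq).
by rewrite mcoeffX eqxx mcoeff0 addr0 => /eqP; rewrite oner_eq0.
Qed.

End BettiNumbers.

(** * Linear steps and the index *)

Section LinearIndex.
Import mpoly.
Local Open Scope ring_scope.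
Variables (K : fieldType) (n : nat).
Implicit Types (A : 'X_{1..n} -> Prop) (J : {mpoly K[n]} -> Prop).

(** Linearity in [r] steps implies linearity in fewer, so [0] is the only admissible [r]. A supremum
    exists, hence [epsilon] returns one, and it can only be [Some 0]. *)
Lemma linear_index_eq1 J :
  steps_linear J 0 -> ~ steps_linear J 1 -> linear_index J = Some 1%N.
Proof.
move=> s0 s1; have sE r : steps_linear J r <-> r = 0%N.
  split=> [|-> //]; case: r => // r [d [J0 Jd lin]]; case: s1; exists d.
  by split=> // i j i1; apply: lin; apply: leq_trans i1 _.
rewrite /linear_index; set s := epsilon _ _.
have : is_sup_nat (steps_linear J) s.
  apply: epsilon_spec; exists (Some 0%N); split; first by exists 0%N.
  by split=> [r /sE -> //|u]; apply.
case: s => [s [_ [_ s_min]]|[_ /(_ 0%N)[r /sE ->]] //] /=.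
suff : (s <= 0)%N by rewrite leqn0 => /eqP ->.
by apply: s_min => r /sE ->.
Qed.

Lemma steps_linear0_equigenerated A a d :
  (forall a, A a -> mdeg a = d) -> A a -> steps_linear (@monomial_ideal K n A) 0.
Proof.
move=> dA Aa; exists d; split.
- exists 'X_[a]; first exact: monomial_idealX Aa (lepm_refl _).
  by rewrite -msupp_eq0 msuppX.
- exists (fun f => exists2 m, A m & f = 'X_[m]) => // f [m Am ->].
  by rewrite dhomogX; apply/eqP/dA.
- by move=> i j; rewrite leqn0 => /eqP -> lt_dj; apply: betti0_eq0 dA _.
Qed.

(** Polynomials whose monomials all have degree at least [d] form an ideal. The degree in
    [steps_linear] is merely asserted to exist; this bounds it by the degree of a known monomial. *)
Lemma generated_in_degree_le J d m :
  generated_in_degree J d -> J 'X_[m] -> (d <= mdeg m)%N.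
Proof.
move=> [B hB JB] /JB Bm.
suff : forall f, ideal_gen B f -> forall m', m' \in msupp f -> (d <= mdeg m')%N.
  by move=> /(_ _ Bm); apply; rewrite msuppX mem_head.
apply: ideal_gen_min; first split=> [m'|f g hf hg m'|f g hg m'].
- by rewrite msupp0.
- by move/msuppD_le; rewrite mem_cat => /orP[/hf|/hg].
- move/msuppM_le/allpairsP=> [[m1 m2] /= [_ /hg ? ->]].
  by rewrite mdegD (leq_trans _ (leq_addl _ _)).
by move=> f /hB/dhomogP hf m' /hf ->.
Qed.

End LinearIndex.

(** * Matchings and the squarefree generators they supply *)

Section Matchings.
Import mpoly.
Variables (n : nat) (e : rel 'I_n).
Hypotheses (e_sym : ssrbool.symmetric e) (e_irrefl : irreflexive e).
Implicit Types (V W : {set 'I_n}) (N : {set {set 'I_n}}).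

Lemma mesym1_sum V : mesym1 V = (\sum_(x in V) U_(x))%MM.
Proof.
apply/mnmP => i; rewrite mnmE mnm_sumE; have [iV|iV] := boolP (i \in V).
  rewrite (bigD1 i) //= mnm1E eqxx big1 // => x /andP[_ xi].
  by rewrite mnm1E (negbTE xi).
by rewrite big1 // => x xV; rewrite mnm1E; case: eqP => // xi; rewrite -xi xV in iV.
Qed.

Lemma mesym1_cover N :
  trivIset N -> mesym1 (cover N) = (\sum_(b in N) mesym1 b)%MM.
Proof.
move=> tN; rewrite mesym1_sum (big_trivIset _ tN) /=.
by apply: eq_bigr => b _; rewrite mesym1_sum.
Qed.

Lemma lem_mesym1 V W : V \subset W -> (mesym1 V <= mesym1 W)%MM.
Proof.
by move/subsetP => VW; apply/mnm_lepP => i; rewrite !mnmE; case: (boolP (i \in V)) => // /VW ->.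
Qed.

Lemma mesym1_squarefree V : squarefree_mon (mesym1 V).
Proof. by move=> i; rewrite mnmE leq_b1. Qed.

Lemma edgesP (b : {set 'I_n}) :
  reflect (exists p q, e p q /\ b = [set p; q]) (b \in edges e).
Proof.
apply: (iffP imsetP) => [[[p q]]|[p [q [epq ->]]]].
  by rewrite inE => epq ->; exists p, q.
by exists (p, q); rewrite ?inE.
Qed.

Lemma edge_product_cover N :
  N \subset edges e -> trivIset N -> edge_product e #|N| (mesym1 (cover N)).
Proof.
move=> /subsetP Ne tN; rewrite (mesym1_cover tN) -big_enum cardE.
have : {subset enum N <= edges e} by move=> b; rewrite mem_enum => /Ne.
elim: (enum N) => [|b s IH] sN; first by exists [::]; rewrite !big_nil.
rewrite big_cons; have [|p [q [epq ->]]] := edgesP b _; first by rewrite sN ?mem_head.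
have -> : mesym1 [set p; q] = (U_(p) + U_(q))%MM.
  rewrite mesym1_sum big_setU1 ?big_set1 //= inE.
  by apply: contraTneq epq => ->; rewrite e_irrefl.
by apply: edge_product_cons => //; apply: IH => c cs; rewrite sN // inE cs orbT.
Qed.

(** A variable enters the product as an endpoint of some factor, and the other endpoint of that
    factor serves as [r]. *)
Lemma edge_product_partner k m q :
  edge_product e k m -> 0 < m q -> exists2 r, e q r & 0 < m r.
Proof.
move=> [s [_ /allP es ->]]; rewrite mnm_sumE lt0n sum_nat_seq_neq0 => /hasP[[i j] ijs] /=.
have pos r : r \in [:: i; j] -> 0 < (\sum_(p <- s) (U_(p.1) + U_(p.2)))%MM r.
  move=> rij; rewrite mnm_sumE lt0n sum_nat_seq_neq0; apply/hasP; exists (i, j) => //=.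
  move: rij; rewrite !inE mnmDE !mnm1E => /orP[] /eqP ->; rewrite eqxx //.
  by rewrite addn1.
have eij := es _ ijs; rewrite mnmDE !mnm1E.
case: (i =P q) => [<- _|_]; first by exists j; rewrite ?pos ?inE ?eqxx ?orbT.
by case: (j =P q) => [<- _|//]; exists i; rewrite ?pos ?inE ?eqxx // e_sym.
Qed.

(** Some restricted matching has more than [k] edges; its distinguished edge [a] is kept together
    with any [k] of the others. *)
Lemma restricted_matching_large k : 0 < k -> k < restricted_matching_number e ->
  exists a N, [/\ a \in edges e, a |: N \subset edges e, trivIset (a |: N), #|N| = k
    & forall b, b \in N -> is_gap e a b].
Proof.
(* Without restricted matchings the number is [1] by convention, which [0 < k < 1] rules out. *)
move=> k_gt0; rewrite /restricted_matching_number; case: ifP => _; last first.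
  by rewrite ltnNge k_gt0.
rewrite ltnNge => /negP kmax.
have /existsP[M /andP[]] : [exists M, restricted_matching e M && (k < #|M|)].
  apply: contraT; rewrite negb_exists => /forallP hM; case: kmax; apply/bigmax_leqP => M rM.
  by have := hM M; rewrite rM /= -leqNgt.
move=> /andP[/andP[Me tM] /exists_inP[a aM /forall_inP gapM]] ltkM.
pose N := [set b in take k (enum (M :\ a))].
have NM : {subset N <= M :\ a}.
  by move=> b; rewrite inE => /mem_take; rewrite mem_enum.
have aNM : a |: N \subset M.
  by apply/subsetP => b /setU1P[-> //|/NM]; rewrite inE => /andP[].
exists a, N; split.
- exact: (subsetP Me).
- exact: subset_trans aNM Me.
- exact: trivIsetS aNM tM.
- rewrite cardsE (card_uniqP _) ?take_uniq ?enum_uniq // size_takel // -cardE.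
  by move: ltkM; rewrite (cardsD1 a M) aM.
by move=> b /NM; rewrite !inE => /andP[ba /gapM]; rewrite ba.
Qed.

(** All generators have degree [2k], which settles step 0. Step 1 fails in degree [2k + 2]:
    [betti1_neq0] applies to [V], the two ends of [a], and a vertex [z] of an edge in [N]. *)
Lemma squarefree_power_steps_linear (K : fieldType) k :
  0 < k -> k < restricted_matching_number e ->
  let J := squarefree_power (edge_ideal e K) k in
  steps_linear J 0 /\ ~ steps_linear J 1.
Proof.
move=> k_gt0 k_lt /=; have [a [N [ae aNe taN cN gapN]]] := restricted_matching_large k_gt0 k_lt.
have [p [q [epq ea]]] := edgesP a ae.
have pq : p != q by apply: contraTneq epq => ->; rewrite e_irrefl.
set A := fun m => min_mon_gens (ideal_pow (edge_ideal e K) k) m /\ squarefree_mon m.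
rewrite /squarefree_power -/A.
have dA m : A m -> mdeg m = k.*2.
  by move=> [/min_mon_gens_edge_ideal_pow /mdeg_edge_product].
have A_cover (P : {set {set 'I_n}}) : P \subset a |: N -> #|P| = k -> A (mesym1 (cover P)).
  move=> PN cP; split; last exact: mesym1_squarefree.
  apply/min_mon_gens_edge_ideal_pow; rewrite -cP; apply: edge_product_cover => //.
    exact: subset_trans PN aNe.
  exact: trivIsetS PN taN.
have aNcov x : x \in a -> x \notin cover N.
  move=> xa; apply/bigcupP => -[b bN xb]; have /andP[] := gapN b bN.
  by move=> /pred0P/(_ x); rewrite /= xa xb.
have pa : p \in a by rewrite ea !inE eqxx.
have qa : q \in a by rewrite ea !inE eqxx orbT.
have aN : a \notin N.
  by apply: contra (aNcov p pa) => aN; apply/bigcupP; exists a.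
have AN : A (mesym1 (cover N)) by apply: A_cover => //; apply: subsetUr.
split; first exact: steps_linear0_equigenerated dA AN.
move=> [d [_ Jd lin]].
have le_d : (d <= k.*2)%N.
  rewrite -(dA _ AN); apply: generated_in_degree_le Jd _.
  exact: monomial_idealX AN (lepm_refl _).
(* Positivity of [k] gives an edge [b] in [N]; exchanging [b] for [a] will produce a generator that
   avoids [z]. *)
have [b bN] : exists b, b \in N by apply/card_gt0P; rewrite cN.
have be : b \in edges e by apply: (subsetP aNe); rewrite !inE bN orbT.
have [z [z' [_ eb]]] := edgesP b be.
have zb : z \in b by rewrite eb !inE eqxx.
have zN : z \in cover N by apply/bigcupP; exists b.
have za : z \notin a by apply: contraTN zN; apply: aNcov.
pose V := cover (a |: N).
have VE : V = a :|: cover N by rewrite /V /cover big_setU1.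
have cV : #|V| = k.+1.*2.
  rewrite -mdeg_mesym1 (mdeg_edge_product (edge_product_cover aNe taN)).
  by rewrite cardsU1 aN cN.
(* [V - p' - x] has [2k] vertices, so a generator dividing it equals it. It contains [q'], whose
   partner [r] is neither [p'] nor [q'] and so lies on some [c] in [N]; the edge [{q', r}] then
   contradicts the gap between [a] and [c]. Both orders of the ends of [a] are needed. *)
have no_gen p' q' m x : a = [set p'; q'] -> p' != q' -> A m -> x \in V -> x != p' -> x != q' ->
    ~~ (m <= mesym1 (V :\ p' :\ x))%MM.
  move=> ea' pq' Am xV xp xq; apply/negP => le_m.
  have p'V : p' \in V by rewrite VE ea' !inE eqxx.
  have q'V : q' \in V by rewrite VE ea' !inE eqxx orbT.
  have em : m = mesym1 (V :\ p' :\ x).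
    apply: (lem_mdeg_eq le_m); rewrite (dA _ Am) mdeg_mesym1; apply: double_inj.
    have := cV; rewrite (cardsD1 p') p'V (cardsD1 x) !inE xp xV /= !add1n doubleS.
    by move=> /succn_inj/succn_inj ->.
  have [/min_mon_gens_edge_ideal_pow km _] := Am.
  have [|r eqr] := edge_product_partner (q := q') km.
    by rewrite em mnmE !inE eq_sym xq q'V eq_sym pq'.
  rewrite em mnmE !inE lt0b => /and3P[_ rp].
  rewrite VE ea' !inE (negbTE rp) /= => /orP[/eqP rq|]; first by rewrite rq e_irrefl in eqr.
  move=> /bigcupP[c cN' rc]; have /andP[_ /exists_inP[]] := gapN c cN'.
  exists [set q'; r]; first by apply/edgesP; exists q', r.
  by apply/andP; split; apply/set0Pn; [exists q' | exists r]; rewrite ?ea' !inE ?rc eqxx ?orbT.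
have /negP[] : betti (@monomial_ideal K n A) 1 #|V| != 0%N.
  apply: (@betti1_neq0 K n A V p q z) => //; rewrite ?VE ?inE ?pa ?qa ?zN ?orbT //.
  - by apply: contraNneq za => ->.
  - by apply: contraNneq za => ->.
  - apply: monomial_idealX AN _; apply: lem_mesym1; rewrite subsetD1 subsetUr /=.
    exact: aNcov.
  - have PN : a |: (N :\ b) \subset a |: N by apply: setUS; apply: subsetDl.
    have cP : #|a |: (N :\ b)| = k.
      by rewrite cardsU1 !inE (negbTE aN) andbF /= -cN (cardsD1 b N) bN.
    apply: monomial_idealX (A_cover _ PN cP) _; apply: lem_mesym1.
    rewrite subsetD1 -VE; apply/andP; split.
      by apply/bigcupsP => c /(subsetP PN) cN'; apply: bigcup_sup.
    apply/bigcupP => -[c /setU1P[->|]]; first by rewrite (negbTE za).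
    rewrite !inE => /andP[cb cN'] zc.
    (* Another edge of the matching through [z] would meet [b]. *)
    have /trivIsetP/(_ b c) := taN; rewrite !inE bN cN' !orbT eq_sym cb => /(_ isT isT isT).
    by move=> /pred0P/(_ z); rewrite /= zb zc.
  move=> m x Am; rewrite -VE => xV xp xq; rewrite (no_gen p q) //=.
  by apply: (no_gen q p) => //; rewrite ?ea 1?setUC // eq_sym.
(* Since [2k + 2 = 1 + (2k + 1)] and [2k + 1] exceeds [d], linearity in step 1 forces this Betti
   number to vanish. *)
by rewrite cV doubleS -[_.+2]add1n lin.
Qed.

End Matchings.

Theorem lemma4p2 (K : fieldType) (n : nat) (e : rel 'I_n)
    (e_sym : symmetric e) (e_irrefl : irreflexive e)
    (no_isolated : forall i : 'I_n, exists j : 'I_n, e i j)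
    (k : nat) (k_gt0 : (0 < k)%N)
    (k_lt : (k < restricted_matching_number e)%N) :
  linear_index (squarefree_power (edge_ideal e K) k) = Some 1%N.
Proof.
have [lin0 nlin1] := squarefree_power_steps_linear e_sym e_irrefl K k_gt0 k_lt.
exact: linear_index_eq1.
Qed.
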